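(* Let $\Delta\ge 1$ and $n\ge 2$ be integers. (1) Let $A$ be an integral matrix with $n$ columns and full column rank that is strictly $\Delta$-modular, let $b$ be an integral vector and $c\in\mathbb{Q}^n$, and suppose that the integer program $\max\{c^\top x: x\in\mathbb{Z}^n,\ Ax\le b\}$ is feasible. Then for every optimal vertex $x^*$ of the linear program $\max\{c^\top x: x\in\mathbb{R}^n,\ Ax\le b\}$ there exists an optimal solution $z^*$ of the integer program such that $$\|x^*-z^*\|_\infty\le\max\{\Delta_{n-1}(A),\Delta_n(A)\}-1.$$ (2) Suppose $\Delta\ge 3$. Then there exist an integral matrix $A$ with $n$ columns and full column rank that is strictly $\Delta$-modular, an integral vector $b$ and $c\in\mathbb{Q}^n$ such that the integer program $\max\{c^\top x: x\in\mathbb{Z}^n,\ Ax\le b\}$ is feasible, and an optimal vertex $x^*$ of the linear program $\max\{c^\top x: x\in\mathbb{R}^n,\ Ax\le b\}$, such that every feasible solution $z^*$ of the integer program satisfies $$\|x^*-z^*\|_\infty=\max\{\Delta_{n-1}(A),\Delta_n(A)\}-2.$$ Moreover, these can be chosen so that the polyhedron $\{x\in\mathbb{R}^n: Ax\le b\}$ is full-dimensional and, for every such $z^*$, the points $x^*$ and $z^*$ do not lie on a common facet of this polyhedron.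
   Context: For a matrix $A$ and a positive integer $k$, $\Delta_k(A):=\max\{|\det M| : M \text{ is a } k\times k \text{ submatrix of } A\}$. A matrix $A$ with $n$ columns is called strictly $\Delta$-modular if $A=TB$ for a totally unimodular matrix $T$ and a square integer matrix $B\in\mathbb{Z}^{n\times n}$ with determinant $\Delta$. An optimal vertex of the linear program is a vertex of the polyhedron $\{x\in\mathbb{R}^n: Ax\le b\}$ that attains the maximum of $c^\top x$ over it. *)

(* Defs.v *)
From HB Require Import structures.
From mathcomp Require Export all_boot all_order all_algebra.
From mathcomp Require Export boolp classical_sets reals matrix_normedtype.
Export Order.TTheory GRing.Theory Num.Theory.

Set Implicit Arguments.
Unset Strict Implicit.
Unset Printing Implicit Defensive.

Local Open Scope ring_scope.
Local Open Scope classical_set_scope.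

Section Subdeterminants.

(* A k x k submatrix is [mxsub f g A] for increasing choices f of its rows and
   g of its columns. *)
Definition increasing_ord (k m : nat) (f : {ffun 'I_k -> 'I_m}) : bool :=
  [forall i : 'I_k, forall j : 'I_k, (i < j)%N ==> (f i < f j)%N].

(* The maximum over an empty family, i.e. when A has no k x k submatrix,
   is 0. *)
Definition max_subdet (k m n : nat) (A : 'M[int]_(m, n)) : nat :=
  \max_(f : {ffun 'I_k -> 'I_m} | increasing_ord f)
    \max_(g : {ffun 'I_k -> 'I_n} | increasing_ord g)
      `|\det (mxsub f g A)|%N.

Definition totally_unimodular (m n : nat) (T : 'M[int]_(m, n)) : Prop :=
  forall (k : nat) (f : {ffun 'I_k -> 'I_m}) (g : {ffun 'I_k -> 'I_n}),
    increasing_ord f -> increasing_ord g ->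
    \det (mxsub f g T) \in [:: -1; 0; 1].

Definition strictly_modular (Delta m n : nat) (A : 'M[int]_(m, n)) : Prop :=
  exists (T : 'M[int]_(m, n)) (B : 'M[int]_n),
    [/\ totally_unimodular T, \det B = Delta%:Z & A = T *m B].

Definition full_column_rank (m n : nat) (A : 'M[int]_(m, n)) : Prop :=
  \rank (map_mx intr A : 'M[rat]_(m, n)) = n.

End Subdeterminants.

Section Polyhedra.
Variables (R : realType) (n : nat).
Implicit Types (P F : set 'cV[R]_n) (x : 'cV[R]_n).

Definition aff_indep (k : nat) (p : 'I_k -> 'cV[R]_n) : Prop :=
  forall l : 'I_k -> R,
    \sum_i l i = 0 -> \sum_i l i *: p i = 0 -> forall i, l i = 0.

(* P has (affine) dimension d; the empty set has no dimension. *)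
Definition has_dim P (d : nat) : Prop :=
  (exists p : 'I_d.+1 -> 'cV[R]_n, (forall i, P (p i)) /\ aff_indep p) /\
  ~ (exists p : 'I_d.+2 -> 'cV[R]_n, (forall i, P (p i)) /\ aff_indep p).

Definition full_dim P : Prop := has_dim P n.

(* The normal w may be 0, so P itself is a face of P. *)
Definition face P F : Prop :=
  exists (w : 'cV[R]_n) (delta : R),
    (forall x, P x -> (w^T *m x) 0 0 <= delta) /\
    F = [set x | P x /\ (w^T *m x) 0 0 = delta].

Definition vertex P x : Prop := face P [set x].

Definition facet P F : Prop :=
  face P F /\ exists d : nat, has_dim P d.+1 /\ has_dim F d.

End Polyhedra.

Section Programs.
Variables (m n : nat) (A : 'M[int]_(m, n)) (b : 'cV[int]_m) (c : 'cV[rat]_n).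

Definition polyhedron (R : realType) : set 'cV[R]_n :=
  [set x | forall i, (map_mx intr A *m x) i 0 <= (b i 0)%:~R].
Arguments polyhedron R : clear implicits.

Definition lp_optimal_vertex (R : realType) (x : 'cV[R]_n) : Prop :=
  vertex (polyhedron R) x /\
  forall y, polyhedron R y ->
    ((map_mx ratr c)^T *m y) 0 0 <= ((map_mx ratr c)^T *m x) 0 0.

Definition ip_feasible (z : 'cV[int]_n) : Prop :=
  forall i, (A *m z) i 0 <= b i 0.

Definition ip_optimal (z : 'cV[int]_n) : Prop :=
  ip_feasible z /\
  forall y, ip_feasible y ->
    (c^T *m map_mx intr y) 0 0 <= (c^T *m map_mx intr z) 0 0.

End Programs.
Arguments polyhedron {m n} A b R.

(* The norm on 'cV[R]_n is the entrywise maximum norm. *)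
Definition dist_infty (R : realType) (n : nat) (x : 'cV[R]_n)
    (z : 'cV[int]_n) : R :=
  `|x - map_mx intr z|.

(* Main.v *)
Require Import Defs.
From mathcomp Require Import perm lra ring zify.

(** Write A = T B with T totally unimodular and det B = Delta, and set y = B x.
    By total unimodularity, the LP vertex x* becomes an integral point y*, and
    B z - y* is, for an optimal z, a sum of integral vectors g which are circuits
    of T and agree in sign with B z - y* in every row of T.  A partial sum of the
    g's lying in the lattice B Z^n, of index Delta, can be subtracted from B z
    without losing feasibility or optimality, so by pigeonhole at most Delta - 1
    circuits remain.  A circuit is a vector of cofactors of n - 1 rows of T, and
    Delta B^-1 g is the vector of the corresponding cofactors of A; hence
    |x* - z*| <= (Delta - 1) Delta_{n-1}(A) / Delta.

    For the lower bound take 0 <= x_i <= Delta - 2 and 0 <= Delta x_0 - x_i <= 1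
    for 1 <= i < n.  The only integral point is 0, and maximizing x_0 gives the
    vertex ((Delta - 1) / Delta, Delta - 2, ..., Delta - 2).  The midpoint of
    these two points is interior, so they share no facet. *)

Set Implicit Arguments.
Unset Strict Implicit.
Unset Printing Implicit Defensive.

Local Open Scope ring_scope.

(** * Subdeterminants and selection of rows *)


Lemma increasing_ordP (k m : nat) (f : {ffun 'I_k -> 'I_m}) :
  reflect (forall i j : 'I_k, (i < j)%N -> (f i < f j)%N) (increasing_ord f).
Proof.
apply: (iffP forallP) => [H i j ij|H i]; first by move/forallP/(_ j)/implyP: (H i); apply.
by apply/forallP => j; apply/implyP/H.
Qed.

Lemma enum_val_mono (m : nat) (S : {set 'I_m}) (i j : 'I_#|S|) :
  (i < j)%N -> (enum_val i < enum_val j)%N.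
Proof.
move=> ij; have sS : sorted ltn [seq val x | x <- enum S].
  rewrite {1}/enum_mem -enumT sorted_map; apply: sorted_filter.
    by move=> a b c /=; apply: ltn_trans.
  by rewrite -sorted_map val_enum_ord iota_ltn_sorted.
have x0 := enum_val i.
have/= := sorted_ltn_nth ltn_trans 0%N sS.
move/(_ i j); rewrite !inE !size_map -!cardE !ltn_ord => /(_ isT isT ij).
by rewrite !(nth_map x0) -?cardE ?ltn_ord // !(enum_val_nth x0).
Qed.

(** The image of [f] is listed in increasing order by [f'], and [s] records the rank of each [f i]
    in that list. *)
Lemma injective_sort (k m : nat) (f : 'I_k -> 'I_m) : injective f ->
  exists (s : 'S_k) (f' : {ffun 'I_k -> 'I_m}),
    increasing_ord f' /\ forall i, f i = f' (s i).
Proof.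
move=> fI; pose S := [set f i | i in 'I_k].
have cS : #|S| = k by rewrite card_imset // card_ord.
have fS i : f i \in S by apply: imset_f.
pose t i := cast_ord cS (enum_rank_in (fS i) (f i)).
pose f' := [ffun i : 'I_k => enum_val (cast_ord (esym cS) i)].
have ft i : f' (t i) = f i by rewrite ffunE cast_ordK enum_rankK_in.
have tI : injective t by move=> i j tij; apply: fI; rewrite -!ft tij.
exists (perm tI), f'; split=> [|i]; last by rewrite permE ft.
by apply/increasing_ordP => i j ij; rewrite !ffunE; apply: enum_val_mono.
Qed.

Lemma increasing_inj (k m : nat) (f : {ffun 'I_k -> 'I_m}) :
  increasing_ord f -> injective f.
Proof.
move/increasing_ordP => fi i j fij; apply/val_inj.
by case: (ltngtP i j) => // /fi; rewrite fij ltnn.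
Qed.

Lemma absz_sign (b : bool) (x : int) : absz ((-1) ^+ b * x) = absz x.
Proof. by rewrite abszM abszX exp1n mul1n. Qed.

Lemma det_mxsub_row_perm (R : comNzRingType) (k m n : nat) (f : 'I_k -> 'I_m)
    (g : 'I_k -> 'I_n) (s : 'S_k) (A : 'M[R]_(m, n)) :
  \det (mxsub (f \o s) g A) = (-1) ^+ s * \det (mxsub f g A).
Proof.
rewrite -det_perm -det_mulmx -row_permE.
by congr (\det _); apply/matrixP => i j; rewrite !mxE.
Qed.

(** Repeated rows or columns make the determinant vanish, and sorting them otherwise changes only
    its sign. Later arguments may thus select rows by arbitrary maps, although submatrices are
    defined through increasing ones. *)
Lemma absz_det_mxsub_increasing (k m n : nat) (f : 'I_k -> 'I_m) (g : 'I_k -> 'I_n)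
    (A : 'M[int]_(m, n)) :
  \det (mxsub f g A) = 0 \/
  exists (f' : {ffun 'I_k -> 'I_m}) (g' : {ffun 'I_k -> 'I_n}),
    [/\ increasing_ord f', increasing_ord g' &
        `|\det (mxsub f g A)|%N = `|\det (mxsub f' g' A)|%N].
Proof.
case: (pselect (injective f)) => [fI|]; last first.
  move/injectiveP/injectivePn => [i [j ij fij]]; left.
  by apply: (determinant_alternate ij) => l; rewrite !mxE fij.
case: (pselect (injective g)) => [gI|]; last first.
  move/injectiveP/injectivePn => [i [j ij gij]]; left.
  by rewrite -det_tr; apply: (determinant_alternate ij) => l; rewrite !mxE gij.
have [s [f' [f'i fE]]] := injective_sort fI.
have [t [g' [g'i gE]]] := injective_sort gI.
right; exists f', g'; split=> //.
rewrite (_ : mxsub f g A = mxsub (f' \o s) g A); last first.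
  by apply/matrixP => i j; rewrite !mxE fE.
rewrite det_mxsub_row_perm absz_sign -det_tr trmx_mxsub.
rewrite (_ : mxsub g f' A^T = mxsub (g' \o t) f' A^T); last first.
  by apply/matrixP => i j; rewrite !mxE gE.
by rewrite det_mxsub_row_perm absz_sign -trmx_mxsub det_tr.
Qed.

Lemma leq_max_subdet (k m n : nat) (f : 'I_k -> 'I_m) (g : 'I_k -> 'I_n)
    (A : 'M[int]_(m, n)) :
  (`|\det (mxsub f g A)| <= max_subdet k A)%N.
Proof.
have [->//|[f' [g' [f'i g'i ->]]]] := absz_det_mxsub_increasing f g A.
rewrite /max_subdet (bigmaxD1 f') // leq_max; apply/orP; left.
by rewrite (bigmaxD1 g') // leq_max leqnn.
Qed.

Lemma totally_unimodularP (k m n : nat) (T : 'M[int]_(m, n)) (f : 'I_k -> 'I_m)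
    (g : 'I_k -> 'I_n) :
  totally_unimodular T -> (`|\det (mxsub f g T)| <= 1)%N.
Proof.
move=> TU; have [->//|[f' [g' [f'i g'i ->]]]] := absz_det_mxsub_increasing f g T.
by have := TU _ _ _ f'i g'i; rewrite !inE => /or3P[]/eqP->.
Qed.

Section RowSelection.
Variables (F : fieldType) (m n : nat).

(** Rows outside [P] are zeroed rather than deleted, so that the type does not depend on the size of
    [P]. *)
Definition mask_rows (P : pred 'I_m) (A : 'M[F]_(m, n)) : 'M[F]_(m, n) :=
  \matrix_(i, j) if P i then A i j else 0.

Lemma mask_rows_mul (P : pred 'I_m) (A : 'M[F]_(m, n)) (v : 'cV_n) :
  mask_rows P A *m v = 0 <-> forall i, P i -> (A *m v) i 0 = 0.
Proof.
split=> [Av i Pi|Av].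
  have /matrixP/(_ i 0) := Av; rewrite mxE [in RHS]mxE => <-; rewrite mxE.
  by apply: eq_bigr => j _; rewrite mxE Pi.
apply/matrixP => i j; rewrite ord1 mxE [RHS]mxE.
case: (boolP (P i)) => Pi; last by apply: big1 => k _; rewrite mxE (negPf Pi) mul0r.
have := Av i Pi; rewrite mxE => AE; rewrite -[RHS]AE.
by apply: eq_bigr => k _; rewrite mxE Pi.
Qed.

(** A zeroed row belongs to no linearly independent family, so a maximal independent family of
    masked rows consists of rows of [A] in [P]. *)
Lemma select_rows (P : pred 'I_m) (A : 'M[F]_(m, n)) (r : nat) :
  \rank (mask_rows P A) = r ->
  exists J : 'I_r -> 'I_m, (forall k, P (J k)) /\ row_free (rowsub J A).
Proof.
move=> <-; set M := mask_rows P A; exists (maxrankfun M).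
have PJ k : P (maxrankfun M k).
  apply: contraT => /negPf NP.
  have : row k (rowsub (maxrankfun M) M) = 0.
    by apply/rowP => j; rewrite !mxE NP.
  have /row_freeP [C MC] := maxrowsub_free M.
  move=> r0; have := congr1 (row k) MC; rewrite row_mul r0 mul0mx.
  by move/rowP/(_ k); rewrite !mxE eqxx => /esym/eqP; rewrite oner_eq0.
split=> //; suff <- : rowsub (maxrankfun M) M = rowsub (maxrankfun M) A.
  exact: maxrowsub_free.
by apply/matrixP => i j; rewrite !mxE PJ.
Qed.

Lemma rank_full_ker (A : 'M[F]_(m, n)) :
  (forall v : 'cV_n, A *m v = 0 -> v = 0) -> \rank A = n.
Proof.
move=> H; rewrite -mxrank_tr; apply/eqP; apply: inj_row_free => v vA.
by apply: trmx_inj; rewrite trmx0; apply: H; apply: trmx_inj; rewrite trmx_mul trmxK vA trmx0.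
Qed.

Lemma rank_full_inj (A : 'M[F]_(m, n)) :
  \rank A = n -> forall v : 'cV_n, A *m v = 0 -> v = 0.
Proof.
rewrite -mxrank_tr => /eqP Af v Av; apply: trmx_inj; rewrite trmx0.
by apply: (row_free_inj Af); rewrite -trmx_mul Av trmx0 mul0mx.
Qed.

Lemma rank_ker_line (A : 'M[F]_(m, n)) (u : 'cV[F]_n) :
  u != 0 -> A *m u = 0 ->
  (forall v : 'cV_n, A *m v = 0 -> exists a, v = a *: u) -> (\rank A).+1 = n.
Proof.
move=> u0 Au H; have lek : (\rank (kermx A^T) <= 1)%N.
  apply: (@leq_trans (\rank u^T)); last exact: rank_leq_row.
  apply/mxrankS/row_subP => i.
  have /H [a aE] : A *m (row i (kermx A^T))^T = 0.
    by apply: trmx_inj; rewrite trmx_mul trmxK trmx0 -row_mul mulmx_ker row0.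
  rewrite -[row i _]trmxK aE linearZ /=; exact: scalemx_sub.
have lerk : (\rank A < n)%N.
  rewrite ltn_neqAle rank_leq_col andbT; apply/eqP => Ar.
  by case/eqP: u0; apply: (rank_full_inj Ar).
have := mxrank_ker A^T; rewrite mxrank_tr => E; lia.
Qed.

End RowSelection.

(** * Circuits and cofactor vectors *)


(** Induction on the size of the support of [A u]. If [u] is not yet determined up to scaling by its
    zero rows, it is replaced by a conformal vector of smaller support. The result is a circuit. *)
Lemma minimal_conformal (F : realFieldType) (m n : nat) (A : 'M[F]_(m, n)) (u : 'cV[F]_n) :
  (forall v : 'cV_n, A *m v = 0 -> v = 0) -> u != 0 ->
  exists u' : 'cV[F]_n,
    [/\ u' != 0,
        forall i, (A *m u) i 0 = 0 -> (A *m u') i 0 = 0,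
        forall i, 0 <= (A *m u') i 0 * (A *m u) i 0 &
        forall v : 'cV_n, (forall i, (A *m u') i 0 = 0 -> (A *m v) i 0 = 0) ->
          exists a, v = a *: u'].
Proof.
move=> Ainj; have [k] := ubnP #|[pred i | (A *m u) i 0 != 0]|.
elim: k u => // k IHk u ltk u0.
case: (pselect (forall v : 'cV_n, (forall i, (A *m u) i 0 = 0 -> (A *m v) i 0 = 0) ->
          exists a, v = a *: u)) => [umin|].
  by exists u; split=> // i; rewrite -expr2 sqr_ge0.
move/existsNP => [v /not_implyP [vsupp vNu]].
have [i0 i0P] : exists i0, (A *m u) i0 0 != 0.
  apply/existsP; apply: contraT => /existsPn H; case/eqP: u0; apply: Ainj.
  by apply/colP => i; rewrite [RHS]mxE; apply/eqP; move: (H i); rewrite negbK.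
(* With r the largest ratio (A v)_i / (A u)_i, the vector r u - v is conformal
   to u and its support misses a row where r is attained. *)
pose r i := (A *m v) i 0 / (A *m u) i 0.
have [i1 i1P i1max] := @arg_maxP _ F _ i0 (fun i => (A *m u) i 0 != 0) r i0P.
pose w := r i1 *: u - v.
have wE i : (A *m w) i 0 = r i1 * (A *m u) i 0 - (A *m v) i 0.
  by rewrite /w mulmxBr -scalemxAr !mxE.
have w0 : w != 0.
  by apply/eqP => /subr0_eq wr; apply: vNu; exists (r i1).
have wsupp i : (A *m u) i 0 = 0 -> (A *m w) i 0 = 0.
  by move=> ui; rewrite wE ui mulr0 (vsupp _ ui) subr0.
have wconf i : 0 <= (A *m w) i 0 * (A *m u) i 0.
  have [ui|ui] := eqVneq ((A *m u) i 0) 0; first by rewrite ui mulr0.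
  have -> : (A *m w) i 0 * (A *m u) i 0 = (r i1 - r i) * (A *m u) i 0 ^+ 2.
    have vE : (A *m v) i 0 = r i * (A *m u) i 0 by rewrite /r mulfVK.
    by rewrite wE vE; ring.
  by rewrite mulr_ge0 ?sqr_ge0 // subr_ge0; apply: i1max.
have [|u' [u'0 u'supp u'conf u'min]] := IHk w _ w0.
  rewrite ltnS in ltk; apply: leq_trans ltk; apply: proper_card; apply/properP; split.
    by apply/fintype.subsetP => i; rewrite !inE; apply: contra => /eqP/wsupp->.
  by exists i1; rewrite !inE // wE /r mulfVK // subrr eqxx.
exists u'; split=> // [i /wsupp/u'supp //|i].
(* Conformality composes: where [A w] vanishes so does [A u'], and elsewhere one multiplies by the
   positive product of [A w] and [A u]. *)
have [wi|wi] := eqVneq ((A *m w) i 0) 0; first by rewrite u'supp ?mul0r.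
have ui : (A *m u) i 0 != 0 by apply: contra wi => /eqP/wsupp->.
have wu : 0 < (A *m w) i 0 * (A *m u) i 0 by rewrite lt_neqAle eq_sym mulf_neq0 //=.
rewrite -(pmulr_lge0 _ wu).
have -> : (A *m u') i 0 * (A *m u) i 0 * ((A *m w) i 0 * (A *m u) i 0)
   = ((A *m u') i 0 * (A *m w) i 0) * (A *m u) i 0 ^+ 2 by ring.
by rewrite mulr_ge0 ?sqr_ge0.
Qed.

Section CrossProduct.
Variables (R : comNzRingType) (n : nat).
Implicit Types (C : 'M[R]_(n, n.+1)).

(** The generalized cross product: the signed maximal minors of [C], orthogonal to all its rows. *)
Definition cross C : 'cV[R]_n.+1 := \col_j ((-1) ^+ j * \det (col' j C)).

Lemma mul_cross k (M : 'M[R]_(k, n.+1)) C i :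
  (M *m cross C) i 0 = \det (col_mx (row i M) C : 'M_n.+1).
Proof.
rewrite (expand_det_row _ 0) mxE; apply: eq_bigr => j _.
rewrite (_ : (0 : 'I_n.+1) = lshift n (ord0 : 'I_1)); last exact: val_inj.
congr (_ * _); first by rewrite [RHS](col_mxEu (row i M) C) mxE.
rewrite mxE /cofactor add0n; congr (_ * \det _).
apply/matrixP => a b; rewrite !mxE /=.
case: splitP => [l /= E|l /= E]; first by case: l E => -[].
by congr (C _ _); apply: val_inj; move: E; rewrite /= /bump /= !add1n => -[].
Qed.

(** Stacking row [i] on the rows [J] again gives rows of [M]. If [M] is totally unimodular, this
    bounds the entries of the product by 1 in absolute value. *)
Lemma rowsub_cross k (M : 'M[R]_(k, n.+1)) (J : 'I_n -> 'I_k) i :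
  exists f : 'I_n.+1 -> 'I_k,
    (M *m cross (rowsub J M)) i 0 = \det (mxsub f id M).
Proof.
exists (fun l : 'I_(1 + n) => match split l with inl _ => i | inr l => J l end).
rewrite mul_cross; congr (\det _); apply/matrixP => a b; rewrite !mxE.
by case: (split _) => ?; rewrite !mxE.
Qed.

Lemma cross_ortho C : C *m cross C = 0.
Proof.
apply/colP => i; rewrite mul_cross [RHS]mxE.
apply: (@determinant_alternate _ _ _ (lshift n (ord0 : 'I_1)) (rshift 1 i)) => [|j].
  by rewrite eq_lrshift.
by rewrite col_mxEu col_mxEd mxE.
Qed.

(** Entry [i] of both sides is the determinant of a product with [B], the other factor being [C]
    below the unit row [i]. Cofactors of rows of [T] thus turn into cofactors of the same rows of
    [T *m B]. *)
Lemma mulmx_cross (B : 'M[R]_n.+1) C : B *m cross (C *m B) = \det B *: cross C.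
Proof.
apply/colP => i; rewrite mul_cross rowE [in RHS]mxE -[cross C]mul1mx mul_cross.
rewrite row1 mulrC -det_mulmx; congr (\det _).
by rewrite -mul_col_mx.
Qed.

End CrossProduct.

Lemma map_cross (R S : comNzRingType) (f : {rmorphism R -> S}) n (C : 'M[R]_(n, n.+1)) :
  map_mx f (cross C) = cross (map_mx f C).
Proof.
by apply/colP => j; rewrite !mxE rmorphM rmorphXn rmorphN1 -map_col' det_map_mx.
Qed.

(** Stacking [u^T] on [C] gives an invertible matrix, since [u] is orthogonal to the rows of [C] and
    [u^T u] is positive in an ordered field. Suitable multiples of [cross C] and [u] have the same
    image under it. *)
Lemma cross_proportional (F : realFieldType) n (C : 'M[F]_(n, n.+1)) (u : 'cV[F]_n.+1) :
  u != 0 -> row_free C -> C *m u = 0 -> exists2 a, a != 0 & cross C = a *: u.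
Proof.
move=> u0 Cf Cu; set b := (u^T *m u) 0 0.
have bgt0 : 0 < b.
  rewrite /b mxE; under eq_bigr do rewrite mxE -expr2.
  rewrite lt_neqAle sumr_ge0 ?andbT => [|i _]; last exact: sqr_ge0.
  rewrite eq_sym; apply: contra u0 => /eqP/psumr_eq0P ui; apply/eqP/colP => i.
  by rewrite [RHS]mxE; apply/eqP; rewrite -sqrf_eq0 ui // => j _; apply: sqr_ge0.
have Duu : u^T *m u = b%:M by rewrite [LHS]mx11_scalar.
pose M : 'M_n.+1 := col_mx u^T C.
have Mf : row_free M.
  apply: inj_row_free => v.
  have [x [y ->]] : exists (x : 'rV_1) (y : 'rV_n), v = row_mx x y :> 'rV_(1 + n).
    by exists (lsubmx (v : 'rV_(1 + n))), (rsubmx (v : 'rV_(1 + n))); rewrite hsubmxK.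
  move=> vM0; have {}vM0 : x *m u^T + y *m C = 0 by rewrite -mul_row_col.
  have x0 : x = 0.
    have := congr1 (mulmx^~ u) vM0.
    rewrite /= mul0mx mulmxDl -!mulmxA Cu mulmx0 addr0 Duu mul_mx_scalar.
    by move/eqP; rewrite scaler_eq0 gt_eqF //= => /eqP.
  move: vM0; rewrite x0 mul0mx add0r => yC.
  have -> : y = 0 by apply: (row_free_inj Cf); rewrite mul0mx.
  by rewrite row_mx0.
have Mu : M \in unitmx by rewrite -row_free_unit.
set a := \det M.
have a0 : a != 0 by rewrite -unitfE -unitmxE.
have aE : u^T *m cross C = a%:M.
  rewrite [LHS]mx11_scalar mul_cross (_ : row 0 u^T = u^T) //.
  by apply/rowP => j; rewrite mxE.
exists (a / b); first by rewrite mulf_neq0 ?invr_eq0 // gt_eqF.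
suff E : b *: cross C = a *: u.
  by rewrite mulrC -scalerA -E scalerA mulVf ?scale1r // gt_eqF.
apply/eqP; rewrite -subr_eq0; apply/eqP.
apply: (can_inj (mulKmx Mu)); rewrite mulmx0.
rewrite [LHS](_ : _ = col_mx (u^T *m (b *: cross C - a *: u)) (C *m (b *: cross C - a *: u))).
  rewrite !mulmxBr -!scalemxAr Cu cross_ortho !scaler0 subrr aE Duu.
  by rewrite !scale_scalar_mx mulrC subrr col_mx0.
by rewrite -mul_col_mx.
Qed.


Definition between0 (p q : int) : Prop := 0 <= p <= q \/ q <= p <= 0.

Lemma between0_sgn (p q : int) : between0 p q -> (0 <= q -> 0 <= p) /\ (q <= 0 -> p <= 0).
Proof. by rewrite /between0; lia. Qed.

Lemma between0_sub (p q : int) : between0 p q -> between0 (q - p) q.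
Proof. by rewrite /between0; lia. Qed.

Lemma between0_leq (p q : int) : between0 p q -> (absz p <= absz q)%N.
Proof. by rewrite /between0; lia. Qed.

Lemma between0_sub_ltn (p q : int) : between0 p q -> p != 0 -> (absz (q - p) < absz q)%N.
Proof. by rewrite /between0; lia. Qed.

(** A nonzero integer [q] has absolute value at least 1, so a [p] of absolute value at most 1 and
    compatible sign cannot pass it. *)
Lemma unit_conformal_between0 (p q : int) :
  (absz p <= 1)%N -> (q = 0 -> p = 0) -> 0 <= p * q -> between0 p q.
Proof.
case: p => [[|[|p]]|[|p]] //; first by case: (lerP 0 q) => q0; [left|right]; lia.
  move=> _ q0 pq; left; have : q <> 0 by move/q0. lia.
move=> _ q0 pq; right; have : q <> 0 by move/q0. lia.
Qed.

Section Elementary.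
Variables (m n : nat) (T : 'M[int]_(m, n.+1)) (B : 'M[int]_n.+1).

(** For nonsingular [B] the vector [h] is det(B) B^-1 g. There are [n.+1] columns, so the bound has
    order one less than their number. *)
Definition elementary (g : 'cV[int]_n.+1) : Prop :=
  exists h : 'cV[int]_n.+1, B *m h = \det B *: g /\
    forall j, `|h j 0| <= (max_subdet n (T *m B))%:Z.

Hypothesis T_TU : totally_unimodular T.
Hypothesis T_inj : forall v : 'cV[rat]_n.+1, map_mx intr T *m v = 0 -> v = 0.

(** The rows of [T] vanishing on a circuit conformal to [u] have rank [n], so the circuit is a
    multiple of the cross product of [n] of them. This product is integral, and total unimodularity
    keeps its row values within those of [u]. *)
Lemma elementary_conformal (u : 'cV[int]_n.+1) : u != 0 ->
  exists g, [/\ g != 0, elementary g &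
    forall i, between0 ((T *m g) i 0) ((T *m u) i 0)].
Proof.
move=> u0; pose Tq : 'M[rat]_(m, n.+1) := map_mx intr T.
pose uq : 'cV[rat]_n.+1 := map_mx intr u.
have uq0 : uq != 0.
  apply: contra u0 => /eqP/matrixP uq0; apply/eqP/matrixP => i j.
  by have := uq0 i j; rewrite !mxE => /eqP; rewrite intr_eq0 => /eqP.
have [u' [u'0 u'supp u'conf u'min]] := minimal_conformal T_inj uq0.
pose P := [pred i | (Tq *m u') i 0 == 0].
have rk : \rank (mask_rows P Tq) = n.
  apply: succn_inj; apply: (rank_ker_line u'0).
    by apply/mask_rows_mul => i /eqP.
  by move=> v /mask_rows_mul vP; apply: u'min => i /eqP /vP.
have [J [PJ Jf]] := select_rows rk.
pose C := rowsub J T.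
have CqE : map_mx intr C = rowsub J Tq by rewrite map_mxsub.
have [|a a0 aE] := cross_proportional u'0 Jf.
  by apply/colP => k; rewrite mul_rowsub_mx !mxE; apply/eqP; have := PJ k; rewrite inE mxE.
(* The sign makes [g] a positive multiple of [u'], hence conformal to [u]. *)
pose g := (-1) ^+ (a < 0)%R *: cross C.
have gE : map_mx intr g = `|a| *: u'.
  by rewrite /g map_mxZ map_cross CqE aE scalerA rmorphXn /= rmorphN1 normrEsign.
exists g; split.
- apply/eqP => g0; move/eqP: gE; rewrite g0 map_mx0 eq_sym scaler_eq0.
  by rewrite normr_eq0 (negPf a0) (negPf u'0).
(* Up to sign the entries are minors of order [n] of [T *m B]. *)
- exists ((-1) ^+ (a < 0)%R *: cross (C *m B)); split.
    by rewrite -scalemxAr mulmx_cross scalerA mulrC -scalerA.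
  move=> j; rewrite mxE normrMsign mxE normrM normrX normrN1 expr1n mul1r.
  rewrite -abszE lez_nat.
  rewrite (_ : col' j _ = mxsub J (lift j) (T *m B)); first exact: leq_max_subdet.
  by rewrite /C mul_rowsub_mx; apply/matrixP => x y; rewrite !mxE.
move=> i.
have Tg1 : (absz ((T *m g) i 0)%R <= 1)%N.
  have [f fE] := rowsub_cross T J i.
  rewrite -scalemxAr mxE [(T *m _) i 0]fE absz_sign.
  exact: totally_unimodularP.
have TgE : ((T *m g) i 0)%:~R = `|a| * (Tq *m u') i 0.
  have := congr1 (fun v => (Tq *m v) i 0) gE.
  by rewrite -map_mxM mxE => ->; rewrite -scalemxAr mxE.
have TuE : ((T *m u) i 0)%:~R = (Tq *m uq) i 0 by rewrite -map_mxM [RHS]mxE.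
have s0 : (T *m u) i 0 = 0 -> (T *m g) i 0 = 0.
  move=> Tu0; apply/eqP; rewrite -(intr_eq0 rat) TgE u'supp ?mulr0 //.
  by rewrite -/Tq -TuE Tu0.
have s1 : 0 <= (T *m g) i 0 * (T *m u) i 0.
  rewrite -(ler0z rat) rmorphM /= TgE TuE -mulrA mulr_ge0 //.
exact: unit_conformal_between0.
Qed.

Lemma conformal_decomposition (u : 'cV[int]_n.+1) :
  exists l : seq 'cV[int]_n.+1,
    [/\ u = \sum_(g <- l) g, forall g, g \in l -> elementary g &
      forall i, (forall g, g \in l -> 0 <= (T *m g) i 0) \/
                (forall g, g \in l -> (T *m g) i 0 <= 0)].
Proof.
(* The induction needs signs relative to [T u] itself, since these pass from [u - g] to [u]. *)
suff [l [lE le lu]] : exists l : seq 'cV[int]_n.+1,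
    [/\ u = \sum_(g <- l) g, forall g, g \in l -> elementary g &
      forall g, g \in l -> forall i, (0 <= (T *m u) i 0 -> 0 <= (T *m g) i 0) /\
                ((T *m u) i 0 <= 0 -> (T *m g) i 0 <= 0)].
  exists l; split=> // i; have [ui|ui] := lerP 0 ((T *m u) i 0).
    by left=> g /lu /(_ i)[+ _]; apply.
  by right=> g /lu /(_ i)[_]; apply; apply: ltW.
(* The l1 norm of [T u] drops with each vector [g] split off, because [T] is injective and so [T g]
   is nonzero. *)
have [k] := ubnP (\sum_i absz ((T *m u) i 0)%R)%N.
elim: k u => // k IHk u; rewrite ltnS => uk.
have [->|u0] := eqVneq u 0; first by exists [::]; rewrite big_nil.
have [g [g0 ge gu]] := elementary_conformal u0.
have [i0 Tg0] : exists i, (T *m g) i 0 != 0.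
  apply/existsP; apply: contraT => /existsPn H; case/eqP: g0.
  have/T_inj : map_mx intr T *m map_mx intr g = 0 :> 'cV[rat]_m.
    rewrite -map_mxM; apply/colP => i; move: (H i); rewrite negbK => /eqP E.
    by rewrite mxE E mxE.
  move/matrixP => E; apply/matrixP => i j; have := E i j; rewrite !mxE.
  by move/eqP; rewrite intr_eq0 => /eqP.
have TB i : (T *m (u - g)) i 0 = (T *m u) i 0 - (T *m g) i 0.
  by rewrite mulmxBr !mxE.
have [|l [lE le lu]] := IHk (u - g).
  apply: leq_trans uk; rewrite (bigD1 i0) //= [leqRHS](bigD1 i0) //= -addSn; apply: leq_add.
    by rewrite TB between0_sub_ltn.
  by apply: leq_sum => i _; rewrite TB; apply/between0_leq/between0_sub.
exists (g :: l); split.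
- by rewrite big_cons -lE addrC subrK.
- by move=> x; rewrite inE => /predU1P[->|/le].
move=> x; rewrite inE => /predU1P[-> i|/lu xu i]; first exact: between0_sgn.
have [+ +] := xu i; rewrite TB => x1 x2.
by have [s1 s2] := between0_sgn (between0_sub (gu i)); split=> [/s1|/s2].
Qed.

Lemma elementary_sum (l : seq 'cV[int]_n.+1) :
  (forall g, g \in l -> elementary g) ->
  exists h : 'cV[int]_n.+1, B *m h = \det B *: (\sum_(g <- l) g) /\
    forall j, `|h j 0| <= ((size l) * max_subdet n (T *m B))%N%:Z.
Proof.
elim: l => [|g l IHl] le.
  by exists 0; rewrite mulmx0 big_nil scaler0; split=> // j; rewrite mxE normr0.
have [h [hE hb]] := le g (mem_head _ _).
have [|h' [h'E h'b]] := IHl; first by move=> x xl; apply: le; rewrite inE xl orbT.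
exists (h + h'); rewrite mulmxDr hE h'E big_cons scalerDr; split=> // j.
rewrite mxE; apply: le_trans (ler_normD _ _) _; rewrite mulSn PoszD.
exact: lerD.
Qed.

End Elementary.

(** * Lattice points and vertices *)


(** The quotient of Z^n by B Z^n has |det B| elements. Smith normal form identifies it with a
    product of cyclic groups, so that a class is a vector of residues. *)
Lemma lattice_pigeonhole (n : nat) (B : 'M[int]_n) (s : nat -> 'cV[int]_n) :
  \det B != 0 ->
  exists (i j : nat) (v : 'cV[int]_n),
    [/\ (i < j)%N, (j <= `|\det B|)%N & s j - s i = B *m v].
Proof.
move=> B0; have [L Lu [R Ru [d _ BE]]] := int_Smith_normal_form B.
have DE : \matrix_(i < n, j < n) (d`_i *+ (i == j :> nat)) = diag_mx (\row_i d`_i).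
  by apply/matrixP => i j; rewrite !mxE.
have unit1 (U : 'M[int]_n) : U \in unitmx -> `|\det U|%N = 1%N.
  by rewrite unitmxE; case/orP => /eqP->.
have dB : `|\det B|%N = (\prod_(i < n) absz (d`_i)%R)%N.
  rewrite BE DE !det_mulmx !abszM (unit1 L) // (unit1 R) // mul1n muln1 det_diag.
  rewrite (big_morph absz abszM (erefl : absz 1 = 1%N)).
  by apply: eq_bigr => i _; rewrite mxE.
have d0 (i : 'I_n) : (0 < absz (d`_i)%R)%N.
  rewrite absz_gt0; apply: contra B0 => /eqP di0.
  rewrite -absz_eq0 dB (bigD1 i) //= di0 mul0n //.
have Bmul (w : 'cV_n) : B *m (invmx R *m w) = L *m (diag_mx (\row_i d`_i) *m w).
  by rewrite BE DE !mulmxA mulmxK.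
pose t k := invmx L *m s k.
have tlt k (i : 'I_n) : (absz ((t k i 0)%R %% (d`_i)%R)%Z < absz (d`_i)%R)%N.
  have di : d`_i != 0 by rewrite -absz_gt0 d0.
  by have := modz_ge0 (t k i 0) di; have := ltz_mod (t k i 0) di; lia.
(* There is one index more than there are residue vectors. *)
pose phi (k : 'I_(`|\det B|).+1) : {dffun forall i : 'I_n, 'I_(absz (d`_i)%R)} :=
  [ffun i : 'I_n => Ordinal (tlt k i)].
have [i [j [ij sij]]] : exists i j : 'I_(`|\det B|).+1, (i < j)%N /\ phi i = phi j.
  case: (pselect (injective phi)) => [/leq_card|/injectiveP/injectivePn[i [j ij pij]]].
    rewrite card_dep_ffun card_ord foldrE big_map big_enum /=.
    by under eq_bigr do rewrite card_ord; rewrite -dB ltnn.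
  case: (ltngtP i j) => ij'; first by exists i, j.
    by exists j, i.
  by move/val_inj: ij' ij => ->; rewrite eqxx.
pose w : 'cV[int]_n := \col_k ((t j k 0 - t i k 0)%R %/ (d`_k)%R)%Z.
exists i, j, (invmx R *m w); split=> //; first by rewrite -ltnS.
rewrite Bmul.
have -> : s j - s i = L *m (t j - t i) by rewrite -mulmxBr mulKVmx.
congr (L *m _); apply/colP => k.
have -> : (t j - t i) k 0 = t j k 0 - t i k 0 by rewrite !mxE.
rewrite mul_diag_mx mxE [X in X * _]mxE [X in _ * X]mxE mulrC divzK //.
have dk : d`_k != 0 by rewrite -absz_gt0 d0.
rewrite -eqz_mod_dvd; move/ffunP/(_ k): sij; rewrite !ffunE => /(congr1 val)/= E.
by rewrite -[X in X == _]gez0_abs ?modz_ge0 // -E gez0_abs ?modz_ge0.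
Qed.

Section Polyhedron.
Variables (R : realType) (m n : nat).
Implicit Types (A : 'M[int]_(m, n)) (b : 'cV[int]_m) (x v : 'cV[R]_n).

Lemma polyhedron_step A b x v : polyhedron A b R x ->
  (forall i, (map_mx intr A *m x) i 0 = (b i 0)%:~R -> (map_mx intr A *m v) i 0 = 0) ->
  exists2 e, 0 < e & polyhedron A b R (x + e *: v).
Proof.
move=> Px tight; pose s i := (b i 0)%:~R - (map_mx intr A *m x) i 0.
pose a i := (map_mx intr A *m v) i 0.
have a1 i : 0 < `|a i| + 1 by rewrite ltr_wpDl.
(* A tight row allows any step, and 1 is a default there. Adding 1 to the denominator avoids
   division by zero. *)
pose e i := if s i == 0 then 1 else s i / (`|a i| + 1).
have s0 i : 0 <= s i by rewrite subr_ge0; apply: Px.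
have e0 i : 0 < e i.
  rewrite /e; case: eqVneq => // si; rewrite divr_gt0 // lt_neqAle eq_sym si //=.
exists (\big[Num.min/1]_i e i); first by apply/bigmin_gtP; split.
move=> i; set d := \big[_/_]_i _.
have de : d <= e i by apply: bigmin_le_cond.
have d0 : 0 < d by apply/bigmin_gtP; split.
rewrite mulmxDr -scalemxAr mxE [X in _ + X]mxE -lerBrDl -/(s i) -/(a i).
have [si|si] := eqVneq (s i) 0.
  by rewrite /a tight ?mulr0 //; apply/esym/eqP; rewrite -subr_eq0 -/(s i) si.
move: de; rewrite /e (negPf si) ler_pdivlMr // => de.
apply: le_trans de; rewrite mulrDr mulr1 -[leLHS]addr0; apply: lerD; last exact: ltW.
by apply: ler_wpM2l; [exact: ltW|exact: ler_norm].
Qed.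

(** A [v] annihilated by the tight rows can be followed a little in both directions, so the normal
    [w] is constant along it, and a nonzero [v] would give a second point of the face. *)
Lemma vertex_tight_inj A b x : vertex (polyhedron A b R) x ->
  forall v, (forall i, (map_mx intr A *m x) i 0 = (b i 0)%:~R ->
                       (map_mx intr A *m v) i 0 = 0) -> v = 0.
Proof.
move=> [w [d [Pd xE]]] v tight.
have [Px wx] : polyhedron A b R x /\ (w^T *m x) 0 0 = d.
  by have : [set x]%classic x by []; rewrite xE.
have [e e0 Pe] := polyhedron_step Px tight.
have [e' e'0 Pe'] : exists2 e, 0 < e & polyhedron A b R (x + e *: - v).
  by apply: polyhedron_step => // i /tight Av; rewrite mulmxN [LHS]mxE Av oppr0.
have wv : (w^T *m v) 0 0 = 0.
  apply/eqP; rewrite eq_le; apply/andP; split.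
    have := Pd _ Pe; rewrite mulmxDr -scalemxAr mxE [X in _ + X]mxE wx.
    by rewrite gerDl pmulr_rle0.
  have := Pd _ Pe'; rewrite mulmxDr -scalemxAr mulmxN mxE [X in _ + X]mxE wx.
  by rewrite gerDl pmulr_rle0 // mxE oppr_le0.
have : [set x]%classic (x + e *: v).
  by rewrite xE; split=> //; rewrite mulmxDr -scalemxAr mxE [X in _ + X]mxE wx wv mulr0 addr0.
move/eqP; rewrite -subr_eq0 addrC addKr scaler_eq0 gt_eqF //= => /eqP //.
Qed.

Lemma vertex_mem (P : set 'cV[R]_n) x : vertex P x -> P x.
Proof. by move=> [w [d [_ xE]]]; have : [set x]%classic x by []; rewrite xE => -[]. Qed.

(** The rows of [T] tight at [B x] have full rank. A nonsingular square selection of them has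
    determinant 1 or -1, so solving for an integral right side gives an integral [B x]. *)
Lemma vertex_lattice (T : 'M[int]_(m, n)) (B : 'M[int]_n) b x :
  totally_unimodular T -> \det B != 0 -> vertex (polyhedron (T *m B) b R) x ->
  exists y : 'cV[int]_n, map_mx intr y = map_mx intr B *m x.
Proof.
move=> TU B0 vx; pose TR : 'M[R]_(m, n) := map_mx intr T.
pose BR : 'M[R]_n := map_mx intr B.
have Bu : BR \in unitmx by rewrite unitmxE det_map_mx unitfE intr_eq0.
pose P := [pred i | (TR *m (BR *m x)) i 0 == (b i 0)%:~R].
have rk : \rank (mask_rows P TR) = n.
  apply: rank_full_ker => v /mask_rows_mul vP.
  rewrite -[v](mulKVmx Bu) -/BR (_ : invmx BR *m v = 0) ?mulmx0 //.
  apply: (vertex_tight_inj vx) => i; rewrite map_mxM -!mulmxA mulKVmx // => /eqP.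
  exact: vP.
have [J [PJ Jf]] := select_rows rk.
pose TJ := rowsub J T.
have TJE : map_mx intr TJ = rowsub J TR by rewrite map_mxsub.
have TJu : TJ \in unitmx.
  rewrite unitmxE; have : \det (rowsub J TR) != 0 by rewrite -unitfE -unitmxE -row_free_unit.
  rewrite -TJE det_map_mx intr_eq0; have := totally_unimodularP J id TU.
  rewrite -/TJ; case: (\det TJ) => [[|[|k]]|[|k]] //.
exists (invmx TJ *m rowsub J b).
have Ju : rowsub J TR \in unitmx by rewrite -row_free_unit.
apply: (can_inj (mulKmx Ju)); rewrite -{1}TJE -map_mxM mulKVmx // mul_rowsub_mx.
by apply/colP => k; rewrite !mxE; have /eqP := PJ k; rewrite mxE => ->.
Qed.

End Polyhedron.

(** * Reduction of optimal solutions *)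


(** Scaling by the denominators of [c] makes the objective integral, and an integral function
    bounded above on a nonempty set attains its maximum. *)
Lemma ip_optimal_exists (R : realType) (m n : nat) (A : 'M[int]_(m, n)) (b : 'cV[int]_m)
    (c : 'cV[rat]_n) (K : R) :
  (exists z, ip_feasible A b z) ->
  (forall z, ip_feasible A b z -> ratr ((c^T *m map_mx intr z) 0 0) <= K) ->
  exists z, ip_optimal A b c z.
Proof.
move=> [z0 z0P] bdd; pose q : int := \prod_j denq (c j 0).
have q0 : 0 < q by apply: prodr_gt0 => j _.
pose val (z : 'cV[int]_n) : int :=
  \sum_j numq (c j 0) * (\prod_(k | k != j) denq (c k 0)) * z j 0.
have valE z : (val z)%:~R = (c^T *m map_mx intr z) 0 0 * q%:~R.
  rewrite mxE mulr_suml /val rmorph_sum; apply: eq_bigr => j _.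
  rewrite !mxE /q [in RHS](bigD1 j) //= !intrM -{2}[c j 0]divq_num_den.
  by field; rewrite intr_eq0 denq_eq0.
pose N := Num.bound (K * q%:~R).
have valN z : ip_feasible A b z -> val z <= N%:Z.
  move=> /bdd zK; rewrite -(ler_int R); apply: le_trans (ltW (unstable.ltr_bound _)).
  have -> : (val z)%:~R = ratr ((c^T *m map_mx intr z) 0 0) * q%:~R :> R.
    by rewrite -[LHS]ratr_int valE rmorphM /= ratr_int.
  by rewrite ler_pM2r ?ltr0z.
pose P k := `[< exists2 z, ip_feasible A b z & N%:Z - val z = k%:Z >].
have exP : exists k, P k.
  exists (absz (N%:Z - val z0)); apply/asboolP; exists z0 => //.
  by rewrite gez0_abs // subr_ge0 valN.
case: (ex_minnP exP) => k /asboolP [z zP zk] kmin; exists z; split=> // y yP.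
have qr0 : 0 < q%:~R :> rat by rewrite ltr0z.
rewrite -(ler_pM2r qr0) -!valE ler_int.
have : (k <= absz (N%:Z - val y))%N.
  apply: kmin; apply/asboolP; exists y => //.
  by rewrite gez0_abs // subr_ge0 valN.
by have := valN _ yP; move: zk; lia.
Qed.

Section Reduction.
Variables (R : realType) (m n : nat) (T : 'M[int]_(m, n)) (B : 'M[int]_n).
Variables (b : 'cV[int]_m) (c : 'cV[rat]_n) (x : 'cV[R]_n) (y : 'cV[int]_n).

Definition sign_coherent (l : seq 'cV[int]_n) : Prop :=
  forall i, (forall g, g \in l -> 0 <= (T *m g) i 0) \/
            (forall g, g \in l -> (T *m g) i 0 <= 0).

Lemma sign_coherent_sub (l p : seq 'cV[int]_n) :
  {subset p <= l} -> sign_coherent l -> sign_coherent p.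
Proof. by move=> pl lS i; have [l0|l0] := lS i; [left|right] => g /pl/l0. Qed.

(** In a row where the terms are nonnegative the partial sum is bounded by the full one, and where
    they are nonpositive it is bounded by the value at [y]. *)
Lemma sum_coherent_le (p q : seq 'cV[int]_n) (i : 'I_m) (d : int) :
  sign_coherent (p ++ q) -> (T *m y) i 0 <= d ->
  (T *m (y + \sum_(g <- p ++ q) g)) i 0 <= d -> (T *m (y + \sum_(g <- p) g)) i 0 <= d.
Proof.
have sumE (l : seq 'cV[int]_n) :
    (T *m (y + \sum_(g <- l) g)) i 0 = (T *m y) i 0 + \sum_(g <- l) (T *m g) i 0.
  by rewrite mulmxDr mxE mulmx_sumr summxE.
move=> pqS; rewrite !sumE big_cat addrA.
have [pq0|pq0] := pqS i => yd pqd.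
  apply: le_trans pqd; rewrite lerDl big_seq sumr_ge0 // => g gq.
  by apply: pq0; rewrite mem_cat gq orbT.
apply: le_trans yd; rewrite gerDl big_seq sumr_le0 // => g gq.
by apply: pq0; rewrite mem_cat gq.
Qed.

Hypothesis B0 : \det B != 0.
Hypothesis yE : map_mx intr y = map_mx intr B *m x.
Hypothesis Px : polyhedron (T *m B) b R x.
Hypothesis x_opt : forall w, polyhedron (T *m B) b R w ->
  ((map_mx ratr c)^T *m w) 0 0 <= ((map_mx ratr c)^T *m x) 0 0.

(** Since [y] is [B x], the hypothesis makes [x + v] feasible for the linear program, where [x] is
    optimal. *)
Lemma lattice_shift_le (v : 'cV[int]_n) :
  (forall i, (T *m (y + B *m v)) i 0 <= b i 0) -> (c^T *m map_mx intr v) 0 0 <= 0.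
Proof.
move=> yv; have : polyhedron (T *m B) b R (x + map_mx intr v).
  move=> i; rewrite map_mxM -mulmxA mulmxDr -yE -map_mxM -map_mxD -map_mxM mxE.
  by rewrite ler_int.
move/x_opt; rewrite mulmxDr mxE gerDl => cv.
rewrite -(ler_rat R) rmorph0; apply: le_trans cv.
rewrite le_eqVlt; apply/orP; left; apply/eqP.
rewrite !mxE rmorph_sum; apply: eq_bigr => j _.
by rewrite !mxE rmorphM /= ratr_int.
Qed.

Lemma basis_point_le i : (T *m y) i 0 <= b i 0.
Proof.
have := Px i; rewrite map_mxM -mulmxA -yE -map_mxM mxE ler_int //.
Qed.

Lemma reduce_optimal (z : 'cV[int]_n) (l : seq 'cV[int]_n) :
  ip_optimal (T *m B) b c z -> B *m z = y + \sum_(g <- l) g -> sign_coherent l ->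
  exists z' l', [/\ ip_optimal (T *m B) b c z', B *m z' = y + \sum_(g <- l') g,
    {subset l' <= l} & (size l' < `|\det B|)%N].
Proof.
have [k] := ubnP (size l); elim: k z l => // k IHk z l; rewrite ltnS => lk.
move=> zopt zE lS; have [small|big] := ltnP (size l) (absz (\det B)).
  exists z, l; split=> //.
pose s i := \sum_(g <- take i l) g.
have [i [j [v [ij jd sE]]]] := lattice_pigeonhole s B0.
(* The block [p] lies between two partial sums congruent modulo the lattice, so it sums to [B v]. *)
pose p := drop i (take j l); pose q := take i l ++ drop j l.
have jl : (j <= size l)%N by apply: leq_trans big.
have tE : take j l = take i l ++ p.
  by rewrite /p -[LHS](cat_take_drop i) take_takel // ltnW.
have pE : \sum_(g <- p) g = B *m v.
  by rewrite -sE /s tE big_cat [RHS]addrC addKr.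
have qpl : perm_eq (q ++ p) l.
  by rewrite -[X in perm_eq _ X](cat_take_drop j) tE /q -!catA perm_cat2l perm_catC.
have pql : perm_eq (p ++ q) l by rewrite perm_catC.
have ql : {subset q <= l} by move=> g gq; rewrite -(perm_mem qpl) mem_cat gq.
have feas i0 : (T *m (y + \sum_(g <- l) g)) i0 0 <= b i0 0.
  by rewrite -zE mulmxA; apply: zopt.1.
have cohS (l' : seq _) : perm_eq l' l -> sign_coherent l'.
  by move=> ll'; apply: sign_coherent_sub lS => g; rewrite (perm_mem ll').
(* Adding only [p] to [y] stays feasible, so moving [x] by [v] cannot improve the linear
   objective. *)
have v0 : (c^T *m map_mx intr v) 0 0 <= 0.
  apply: lattice_shift_le => i0; rewrite -pE.
  apply: (sum_coherent_le (cohS _ pql) (basis_point_le i0)).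
  by rewrite (perm_big _ pql).
have zvE : B *m (z - v) = y + \sum_(g <- q) g.
  by rewrite mulmxBr zE -pE -(perm_big _ qpl) big_cat /= addrA addrK.
(* Adding only [q] stays feasible too, and removing [v] from [z] does not lower the objective. *)
have zv : ip_optimal (T *m B) b c (z - v).
  split=> [i0|w /zopt.2 wz].
    rewrite -mulmxA zvE; apply: (sum_coherent_le (cohS _ qpl) (basis_point_le i0)).
    by rewrite (perm_big _ qpl).
  apply: le_trans wz _; rewrite map_mxB mulmxBr [leRHS]mxE [X in _ + X]mxE.
  by rewrite lerDl oppr_ge0.
have [|z' [l' [z'opt z'E l'q l'small]]] := IHk _ _ _ zv zvE (sign_coherent_sub ql lS).
  apply: leq_trans lk; rewrite size_cat size_drop size_take_min.
  by rewrite (minn_idPl _) ?(leq_trans (ltnW ij)) //; lia.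
by exists z', l'; split=> // g /l'q/ql.
Qed.

End Reduction.

(** Some [n] rows of [T] have a nonzero integral determinant, by which det B is multiplied in the
    same rows of [T *m B]. *)
Lemma subdet_ge_det (m n : nat) (T : 'M[int]_(m, n)) (B : 'M[int]_n) :
  \rank (map_mx intr T : 'M[rat]_(m, n)) = n -> (`|\det B| <= max_subdet n (T *m B))%N.
Proof.
move=> rT; have mE : mask_rows predT (map_mx intr T) = map_mx intr T :> 'M[rat]_(m, n).
  by apply/matrixP => i j; rewrite !mxE.
have [|J [_ Jf]] := @select_rows _ _ _ predT (map_mx intr T : 'M[rat]_(m, n)) n.
  by rewrite mE.
have dJ : \det (rowsub J T) != 0.
  by rewrite -(intr_eq0 rat) -det_map_mx map_mxsub -unitfE -unitmxE -row_free_unit.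
apply: leq_trans (leq_max_subdet J id _).
by rewrite -mul_rowsub_mx det_mulmx abszM leq_pmull // absz_gt0.
Qed.

Lemma full_column_rank_factor (m n : nat) (T : 'M[int]_(m, n)) (B : 'M[int]_n) :
  \det B != 0 -> full_column_rank (T *m B) ->
  forall v : 'cV[rat]_n, map_mx intr T *m v = 0 -> v = 0.
Proof.
move=> B0 rA v Tv; pose Bq : 'M[rat]_n := map_mx intr B.
have Bu : Bq \in unitmx by rewrite unitmxE det_map_mx unitfE intr_eq0.
rewrite -[v](mulKVmx Bu) (_ : invmx Bq *m v = 0) ?mulmx0 //.
by apply: (rank_full_inj rA); rewrite map_mxM -mulmxA mulKVmx.
Qed.

Lemma mx_norm_le (R : realType) (n : nat) (x : 'cV[R]_n) (d : R) :
  0 <= d -> (forall i, `|x i 0| <= d) -> `|x| <= d.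
Proof.
move=> d0 xd; rewrite [X in X <= _](_ : _ = mx_norm x) //.
have [->//|/mx_norm_neq0 [[i j] ->]] := eqVneq (mx_norm x) 0.
by rewrite /= ord1.
Qed.

Lemma proximity (R : realType) (m n Delta : nat) (A : 'M[int]_(m, n.+1)) (b : 'cV[int]_m)
    (c : 'cV[rat]_n.+1) (x : 'cV[R]_n.+1) :
  (1 <= Delta)%N -> full_column_rank A -> strictly_modular Delta A ->
  (exists z, ip_feasible A b z) -> lp_optimal_vertex A b c x ->
  exists z, ip_optimal A b c z /\
    dist_infty x z <= (maxn (max_subdet n A) (max_subdet n.+1 A))%:R - 1.
Proof.
move=> D1 rA [T [B [TU DB AE]]] feas [vx xopt]; rewrite {}AE in rA feas vx xopt *.
have B0 : \det B != 0 by rewrite DB; lia.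
have [y yE] := vertex_lattice TU B0 vx; have Px := vertex_mem vx.
have T_inj := full_column_rank_factor B0 rA.
have [z0 z0opt] : exists z, ip_optimal (T *m B) b c z.
  apply: (@ip_optimal_exists R _ _ _ _ _ (((map_mx ratr c)^T *m x) 0 0)) => // z zP.
  have -> : ratr ((c^T *m map_mx intr z) 0 0) = ((map_mx ratr c)^T *m map_mx intr z) 0 0 :> R.
    rewrite !mxE rmorph_sum; apply: eq_bigr => j _.
    by rewrite !mxE rmorphM /= ratr_int.
  by apply: xopt => i; rewrite -map_mxM mxE ler_int.
have [l [lE le lS]] := conformal_decomposition B TU T_inj (B *m z0 - y).
have z0E : B *m z0 = y + \sum_(g <- l) g by rewrite -lE addrC subrK.
have [z [l' [zopt zE l'l l'D]]] := reduce_optimal B0 yE Px xopt z0opt z0E lS.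
exists z; split=> //.
have [h [hE hb]] := elementary_sum (fun g gl => le g (l'l g gl)).
set D := max_subdet n _ in hb *; set D' := max_subdet n.+1 _.
have DD' : (Delta <= D')%N.
  rewrite -[Delta]/(absz Delta%:Z) -DB; apply: subdet_ge_det.
  exact: rank_full_ker.
have BR : map_mx intr B \in (unitmx : {pred 'M[R]_n.+1}).
  by rewrite unitmxE det_map_mx unitfE intr_eq0.
(* Applying [B] turns both sides into minus [Delta] times the sum of the remaining circuits. *)
have xz : Delta%:R *: (x - map_mx intr z) = - map_mx intr h :> 'cV[R]_n.+1.
  apply: (can_inj (mulKmx BR)); rewrite -scalemxAr mulmxBr -yE -!map_mxM zE map_mxD.
  rewrite opprD addNKr mulmxN -map_mxM hE DB map_mxZ scalerN //.
have Dgt0 : 0 < Delta%:R :> R by rewrite ltr0n.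
rewrite /dist_infty; apply: mx_norm_le.
  by rewrite subr_ge0 ler1n; lia.
move=> j; rewrite -(ler_pM2l Dgt0) -[X in X * `|_|]gtr0_norm // -normrM.
have := congr1 (fun M : 'cV[R]_n.+1 => M j 0) xz.
rewrite mxE => ->; rewrite !mxE normrN -intr_norm.
apply: (@le_trans _ _ (size l' * D)%N%:R).
  by rewrite -[X in _ <= X]/((size l' * D)%N%:Z%:~R) ler_int.
(* With M the maximum, it remains to bound [size l' * D + Delta] by Delta M. This follows from
   [size l'] being at most Delta - 1 and both [D] and [Delta] being at most M. *)
rewrite mulrBr mulr1 lerBrDr -natrM -natrD ler_nat.
have : (size l' <= Delta.-1)%N by move: l'D; rewrite DB /=; lia.
move: DD'; set M := maxn D D'; have DM : (D <= M)%N by rewrite leq_maxl.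
have D'M : (D' <= M)%N by rewrite leq_maxr.
move=> DD' sl; have {DD'} DM' : (Delta <= M)%N by apply: leq_trans D'M.
have : (size l' * D <= Delta.-1 * M)%N by apply: leq_mul.
nia.
Qed.

(** * Network matrices and full-dimensional polyhedra *)


Section NetworkMatrices.

(** A row of the arc-node incidence matrix of a directed graph, where an arc may lack one or both
    ends. *)
Definition network_row (k : nat) (r : 'I_k -> int) : Prop :=
  [/\ forall j, r j \in [:: -1; 0; 1],
      forall j j', r j = 1 -> r j' = 1 -> j = j' &
      forall j j', r j = -1 -> r j' = -1 -> j = j'].

(** If both signs occur they cancel, and otherwise at most one entry is nonzero. *)
Lemma network_row_sum (k : nat) (r : 'I_k -> int) : network_row r ->
  \sum_j r j = 0 \/ exists j, forall j', j' != j -> r j' = 0.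
Proof.
move=> [r3 rP rN].
have r0 j : r j <> 1 -> r j <> -1 -> r j = 0.
  by have := r3 j; rewrite !inE => /or3P[]/eqP.
have [[j rj]|NP] := pselect (exists j, r j = 1); last first.
  have [[j rj]|NN] := pselect (exists j, r j = -1).
    right; exists j => j' jj'; apply: r0 => rj'; first by apply: NP; exists j'.
    by move: jj'; rewrite (rN _ _ rj' rj) eqxx.
  by left; apply: big1 => j _; apply: r0 => rj; [apply: NP|apply: NN]; exists j.
have [[i ri]|NN] := pselect (exists j, r j = -1); last first.
  right; exists j => j' jj'; apply: r0 => rj'; last by apply: NN; exists j'.
  by move: jj'; rewrite (rP _ _ rj' rj) eqxx.
left; have ij : i != j by apply/eqP => E; move: ri; rewrite E rj.
rewrite (bigD1 j) //= (bigD1 i) //= big1 ?addr0 ?rj ?ri //.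
move=> l /andP[lj li]; apply: r0 => rl.
  by move: lj; rewrite (rP _ _ rl rj) eqxx.
by move: li; rewrite (rN _ _ rl ri) eqxx.
Qed.

Lemma network_row_comp (k n : nat) (g : 'I_k -> 'I_n) (r : 'I_n -> int) :
  injective g -> network_row r -> network_row (r \o g).
Proof.
move=> gI [r3 rP rN]; split=> [j|j j' ? ?|j j' ? ?]; first exact: r3.
  by apply/gI/rP.
by apply/gI/rN.
Qed.

(** A row with at most one nonzero entry allows expansion and induction. If there is none, every row
    sums to 0 and the all-ones vector lies in the kernel. *)
Lemma network_det (k : nat) (M : 'M[int]_k) :
  (forall i, network_row (M i)) -> \det M \in [:: -1; 0; 1].
Proof.
elim: k M => [|k IHk] M MN; first by rewrite det_mx00.
have [[i [j Mij]]|sum0] := pselect (exists i j, forall j', j' != j -> M i j' = 0).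
  rewrite (expand_det_row _ i) (bigD1 j) //= big1 => [|l lj]; last by rewrite Mij // mul0r.
  rewrite addr0 /cofactor.
  have : \det (row' i (col' j M)) \in [:: -1; 0; 1].
    apply: IHk => a.
    have := network_row_comp (@lift_inj _ j) (MN (lift i a)).
    by congr network_row; apply/funext => l; rewrite /= !mxE.
  have [+ _ _] := MN i => /(_ j); rewrite -signr_odd.
  by rewrite !inE => /or3P[]/eqP-> /or3P[]/eqP->; case: (odd _).
suff -> : \det M = 0 by [].
apply/eqP; rewrite -det_tr; apply/det0P; exists (const_mx 1).
  by apply/eqP => /rowP/(_ ord0); rewrite !mxE.
apply/rowP => i; rewrite !mxE.
have [s0|ex] := network_row_sum (MN i); last by case: sum0; exists i.
by rewrite -[RHS]s0; apply: eq_bigr => j _; rewrite !mxE mul1r.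
Qed.

Lemma network_totally_unimodular (m n : nat) (T : 'M[int]_(m, n)) :
  (forall i, network_row (T i)) -> totally_unimodular T.
Proof.
move=> TN k f g fi gi; apply: network_det => i.
have := network_row_comp (increasing_inj gi) (TN (f i)).
by congr network_row; apply/funext => l; rewrite /= !mxE.
Qed.

End NetworkMatrices.

Section FullDimensional.
Variables (R : realType) (m n : nat) (A : 'M[int]_(m, n)) (b : 'cV[int]_m).

(** Prefixing a coordinate 1 turns affine independence into linear independence in dimension
    [n.+1]. *)
Lemma aff_dep_gt (d : nat) (p : 'I_d -> 'cV[R]_n) : (n.+1 < d)%N -> ~ aff_indep p.
Proof.
move=> nd pI; pose M : 'M[R]_(d, 1 + n) := row_mx (const_mx 1) (\matrix_(i, j) p i j 0).
have /inj_row_free : forall v : 'rV_d, v *m M = 0 -> v = 0.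
  move=> v; rewrite mul_mx_row => vM.
  have v1 := congr1 lsubmx vM; have vp := congr1 rsubmx vM.
  rewrite row_mxKl linear0 in v1; rewrite row_mxKr linear0 in vp.
  apply/rowP => i; rewrite [RHS]mxE; apply: (pI (v 0)).
    have /matrixP/(_ 0 0) := v1; rewrite [RHS]mxE; apply: etrans.
    by rewrite [RHS]mxE; apply: eq_bigr => j _; rewrite mxE mulr1.
  apply/colP => k; rewrite summxE [RHS]mxE.
  have /matrixP/(_ 0 k) := vp; rewrite [RHS]mxE; apply: etrans.
  by rewrite [RHS]mxE; apply: eq_bigr => j _; rewrite !mxE.
by move=> Mf; have := rank_leq_col M; rewrite (eqP Mf) add1n leqNgt nd.
Qed.

(** From a point without tight rows one can move along every axis; the point and its [n] translates
    are affinely independent. *)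
Lemma strictly_feasible_full_dim (q : 'cV[R]_n) :
  (forall i, (map_mx intr A *m q) i 0 < (b i 0)%:~R) -> full_dim (polyhedron A b R).
Proof.
move=> qA; split; last by move=> [p [_ /aff_dep_gt]]; apply.
have Pq : polyhedron A b R q by move=> i; apply: ltW.
have /choice [e eP] : forall j : 'I_n, exists e, 0 < e /\ polyhedron A b R (q + e *: delta_mx j 0).
  move=> j; have [|e e0 Pe] := @polyhedron_step _ _ _ _ _ _ (delta_mx j 0) Pq.
    by move=> i Ai; have := qA i; rewrite Ai ltxx.
  by exists e.
exists (fun i => if unlift ord0 i is Some j then q + e j *: delta_mx j 0 else q); split.
  by move=> i; case: unliftP => [j _|_] //; apply: (eP j).2.
move=> l; rewrite !big_ord_recl unlift_none => s0 lE.
have {}lE : \sum_j (l (lift ord0 j) * e j) *: delta_mx j 0 = 0 :> 'cV[R]_n.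
  move: lE; under eq_bigr do rewrite liftK scalerDr scalerA.
  by rewrite big_split /= -scaler_suml addrA -scalerDl s0 scale0r add0r.
have l0 j : l (lift ord0 j) = 0.
  have /colP/(_ j) := lE; rewrite summxE [RHS]mxE (bigD1 j) //= big1 => [|k kj].
    rewrite addr0 !mxE !eqxx mulr1 => /eqP; rewrite mulf_eq0.
    by rewrite (gt_eqF (eP j).1) orbF => /eqP.
  by rewrite !mxE eq_sym (negPf kj) /= mulr0.
move=> i; case: (unliftP ord0 i) => [j|] -> //.
by move: s0; rewrite big1 ?addr0.
Qed.

(** A face containing [x] and [z] contains their midpoint [q]. A functional maximal at the interior
    point [q] is zero, so the face is the whole polyhedron, against its smaller dimension. *)
Lemma strictly_feasible_facet (q x z : 'cV[R]_n) (F : set 'cV[R]_n) :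
  (forall i, (map_mx intr A *m q) i 0 < (b i 0)%:~R) -> q = 2^-1 *: (x + z) ->
  facet (polyhedron A b R) F -> F x -> ~ F z.
Proof.
move=> qA qE [[w [d [Pd FE]]] [k [[[p [pP pI]] _] [_ NF]]]] Fx Fz; apply: NF.
exists p; split=> // i; rewrite FE; split=> //.
have [Px wx] : polyhedron A b R x /\ (w^T *m x) 0 0 = d by move: Fx; rewrite FE.
have [Pz wz] : polyhedron A b R z /\ (w^T *m z) 0 0 = d by move: Fz; rewrite FE.
have Pq : polyhedron A b R q by move=> j; apply: ltW.
have wq : (w^T *m q) 0 0 = d.
  by rewrite qE -scalemxAr mulmxDr mxE [X in _ * X]mxE wx wz; lra.
have w0 (v : 'cV[R]_n) : (w^T *m v) 0 0 <= 0.
  have [|e e0 Pe] := @polyhedron_step _ _ _ _ _ _ v Pq.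
    by move=> j Aj; have := qA j; rewrite Aj ltxx.
  have := Pd _ Pe; rewrite mulmxDr -scalemxAr mxE [X in _ + X]mxE wq.
  by rewrite gerDl pmulr_rle0.
have := w0 (p i - q); have := w0 (q - p i).
rewrite !mulmxBr mxE [X in _ + X]mxE wq => h1; rewrite mxE [X in _ + X]mxE wq => h2.
by apply/eqP; rewrite eq_le; apply/andP; split; lra.
Qed.

End FullDimensional.

(** * The lower bound example *)


Lemma network_row_unit_diff (k : nat) (a b : option 'I_k) :
  network_row (fun l => (Some l == a)%:R - (Some l == b)%:R : int).
Proof.
split=> [l|l l'|l l']; first by do 2 case: (_ == _).
  have h l0 : (Some l0 == a)%:R - (Some l0 == b)%:R = 1 :> int -> Some l0 = a.
    by do 2 case: eqP.
  by move=> /h la /h l'a; apply/Some_inj; rewrite la l'a.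
have h l0 : (Some l0 == a)%:R - (Some l0 == b)%:R = -1 :> int -> Some l0 = b.
  by do 2 case: eqP.
by move=> /h la /h l'a; apply/Some_inj; rewrite la l'a.
Qed.

Lemma ip_feasible_polyhedron (R : realType) (m n : nat) (A : 'M[int]_(m, n)) (b : 'cV[int]_m)
    (z : 'cV[int]_n) :
  ip_feasible A b z <-> polyhedron A b R (map_mx intr z).
Proof.
have E i : (map_mx intr A *m map_mx intr z) i 0 = ((A *m z) i 0)%:~R :> R.
  by rewrite -map_mxM mxE.
by split=> zP i; have := zP i; rewrite E ler_int.
Qed.

Lemma mx_norm_ge (R : realType) (n : nat) (x : 'cV[R]_n) (i : 'I_n) : `|x i 0| <= `|x|.
Proof.
rewrite [X in _ <= X](_ : _ = mx_norm x) // mx_normrE.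
exact: (le_bigmax_cond _ (fun ij => `|x ij.1 ij.2|) (j := (i, 0))).
Qed.

Lemma delta_mxTE (S : nzRingType) n (v : 'cV[S]_n.+1) :
  ((delta_mx ord0 0 : 'cV[S]_n.+1)^T *m v) 0 0 = v ord0 0.
Proof. by rewrite trmx_delta -rowE mxE. Qed.

Section TightExample.
Variables (Delta N : nat).
Hypothesis Delta_ge3 : (3 <= Delta)%N.

(* A row of the network matrix, the unit vector of the first end minus that of
   the second one.  In the coordinates [y 0 = Delta * x 0] and [y j = x j], the
   rows are [y j] and [y 0 - y j] together with their negatives. *)
Definition ex_ends (k : bool * bool * 'I_N.+1) : option 'I_N.+2 * option 'I_N.+2 :=
  let: (s, t, j) := k in
  let e := if t then (Some (lift ord0 j), None) else (Some ord0, Some (lift ord0 j)) in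
  if s then (e.2, e.1) else e.

Definition ex_T : 'M[int]_(#|{: bool * bool * 'I_N.+1}|, N.+2) :=
  \matrix_(i, l) ((Some l == (ex_ends (enum_val i)).1)%:R -
                  (Some l == (ex_ends (enum_val i)).2)%:R).

Definition ex_d : 'rV[int]_N.+2 := \row_l if l == ord0 then Delta%:Z else 1.

Definition ex_A := ex_T *m diag_mx ex_d.

(** The flag [s] marks the negated rows, whose right side 0 gives the lower bounds. *)
Definition ex_b : 'cV[int]_#|{: bool * bool * 'I_N.+1}| :=
  \col_i let: (s, t, _) := enum_val i in
    if s then 0 else if t then Delta%:Z - 2 else 1.

Lemma ex_rowE (S : comNzRingType) (v : 'cV[S]_N.+2) s t j :
  (map_mx intr ex_A *m v) (enum_rank (s, t, j)) 0 =
    (-1) ^+ s * (if t then v (lift ord0 j) 0 else Delta%:R * v ord0 0 - v (lift ord0 j) 0).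
Proof.
pose y l : S := (ex_d 0 l)%:~R * v l 0.
have sumE (o : option 'I_N.+2) :
    \sum_l (Some l == o)%:R * y l = if o is Some l then y l else 0.
  case: o => [l|]; last by apply: big1 => l _; rewrite mul0r.
  rewrite (bigD1 l) //= eqxx mul1r big1 ?addr0 // => l' /negPf l'l.
  by rewrite (inj_eq Some_inj) l'l mul0r.
have -> : (map_mx intr ex_A *m v) (enum_rank (s, t, j)) 0 =
    \sum_l (Some l == (ex_ends (s, t, j)).1)%:R * y l -
    \sum_l (Some l == (ex_ends (s, t, j)).2)%:R * y l.
  rewrite mxE -sumrB; apply: eq_bigr => l _.
  rewrite mxE /ex_A mul_mx_diag mxE [ex_T _ _]mxE enum_rankK rmorphM rmorphB /= !rmorph_nat.
  by rewrite -mulrA mulrBl.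
have y0 : y ord0 = Delta%:R * v ord0 0 by rewrite /y mxE eqxx.
have yj : y (lift ord0 j) = v (lift ord0 j) 0 by rewrite /y mxE mul1r.
by rewrite !sumE; case: s t => [] [] /=; rewrite ?y0 ?yj; ring.
Qed.

Lemma ex_polyhedronP (R : realType) (v : 'cV[R]_N.+2) :
  polyhedron ex_A ex_b R v <->
  forall j, 0 <= v (lift ord0 j) 0 <= Delta%:R - 2 /\
            0 <= Delta%:R * v ord0 0 - v (lift ord0 j) 0 <= 1.
Proof.
split=> [Pv j|vP i].
  have := Pv (enum_rank (false, true, j)); have := Pv (enum_rank (true, true, j)).
  have := Pv (enum_rank (false, false, j)); have := Pv (enum_rank (true, false, j)).
  rewrite !ex_rowE !mxE !enum_rankK /= rmorphB /=; split; lra.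
have := enum_valK i; case: (enum_val i) => [[s t] j] <-; rewrite ex_rowE mxE enum_rankK.
have := vP j; case: s t => [] [] /=; rewrite ?rmorphB /=; lra.
Qed.

Lemma ex_T_TU : totally_unimodular ex_T.
Proof.
apply: network_totally_unimodular => i.
have := network_row_unit_diff (ex_ends (enum_val i)).1 (ex_ends (enum_val i)).2.
by congr network_row; apply/funext => l; rewrite mxE.
Qed.

Lemma ex_det : \det (diag_mx ex_d) = Delta%:Z.
Proof.
by rewrite det_diag big_ord_recl mxE eqxx big1 ?mulr1 // => i _; rewrite mxE.
Qed.

Lemma ex_strictly_modular : strictly_modular Delta ex_A.
Proof. by exists ex_T, (diag_mx ex_d); split; [exact: ex_T_TU|exact: ex_det|]. Qed.

Lemma ex_full_column_rank : full_column_rank ex_A.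
Proof.
apply: rank_full_ker => v vA.
have v1 j : v (lift ord0 j) 0 = 0.
  by have := ex_rowE v false true j; rewrite vA mxE /= mul1r.
have v0 : v ord0 0 = 0.
  have := ex_rowE v false false ord0; rewrite vA mxE /= mul1r v1 subr0 => /esym/eqP.
  by rewrite mulf_eq0 pnatr_eq0 => /orP[|/eqP //]; lia.
by apply/colP => i; rewrite [RHS]mxE; case: (unliftP ord0 i) => [j|] ->.
Qed.

(** A submatrix is a submatrix of [ex_T] with scaled columns, and distinct columns contribute the
    factor [Delta] at most once. *)
Lemma ex_max_subdet_le k : (max_subdet k ex_A <= Delta)%N.
Proof.
apply/bigmax_leqP => f fi; apply/bigmax_leqP => g gi.
have -> : mxsub f g ex_A = mxsub f g ex_T *m diag_mx (\row_i ex_d 0 (g i)).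
  by apply/matrixP => i j; rewrite /ex_A !mul_mx_diag !mxE.
rewrite det_mulmx abszM det_diag.
apply: (@leq_trans (1 * Delta)%N); last by rewrite mul1n.
apply: leq_mul; first exact: totally_unimodularP ex_T_TU.
have [[i gi0]|g0] := pselect (exists i, g i = ord0); last first.
  rewrite big1 => [|i _]; first lia.
  by rewrite !mxE; case: eqP => // gi0; case: g0; exists i.
rewrite (bigD1 i) //= big1 => [|l li]; first by rewrite !mxE gi0 eqxx mulr1.
rewrite !mxE; case: eqP => // gl0; case/eqP: li.
by apply: (increasing_inj gi); rewrite gl0 gi0.
Qed.

Lemma ex_max_subdet : maxn (max_subdet N.+1 ex_A) (max_subdet N.+2 ex_A) = Delta.
Proof.
apply/eqP; rewrite eqn_leq geq_max !ex_max_subdet_le /= leq_max; apply/orP; right.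
rewrite -[leqLHS]/(absz Delta%:Z) -ex_det; apply: subdet_ge_det.
apply: rank_full_ker; apply: full_column_rank_factor ex_full_column_rank.
by rewrite ex_det; lia.
Qed.

Variable R : realType.

Definition ex_x : 'cV[R]_N.+2 :=
  \col_l if l == ord0 then (Delta%:R - 1) / Delta%:R else Delta%:R - 2.

Let D0 : 0 < Delta%:R :> R. Proof. by rewrite ltr0n; lia. Qed.
Let D3 : 3 <= Delta%:R :> R. Proof. by rewrite ler_nat. Qed.

Lemma ex_x0 : Delta%:R * ex_x ord0 0 = Delta%:R - 1.
Proof. by rewrite mxE eqxx mulrC divfK // gt_eqF. Qed.

Lemma ex_xj j : ex_x (lift ord0 j) 0 = Delta%:R - 2.
Proof. by rewrite mxE. Qed.

(** At the midpoint the bounded quantities are (Delta - 2)/2 and 1/2. The summand 0 is the integral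
    point, kept to match the form needed for facets. *)
Lemma ex_strictly_feasible i :
  (map_mx intr ex_A *m (2^-1 *: (ex_x + 0))) i 0 < (ex_b i 0)%:~R.
Proof.
have hE l : (2^-1 *: ex_x) l 0 = 2^-1 * ex_x l 0 by rewrite mxE.
rewrite addr0; have := enum_valK i; case: (enum_val i) => [[s t] j] <-.
rewrite ex_rowE [ex_b _ _]mxE enum_rankK !hE mulrCA ex_x0 ex_xj.
have := D3; case: s t => [] [] /=; rewrite ?rmorphB /=; lra.
Qed.

(** Adding the upper bounds on Delta v_0 - v_1 and v_1 gives Delta v_0 <= Delta - 1. *)
Lemma ex_objective_le (v : 'cV[R]_N.+2) : polyhedron ex_A ex_b R v ->
  v ord0 0 <= ex_x ord0 0.
Proof.
move=> /ex_polyhedronP /(_ ord0) vP; rewrite -(ler_pM2l D0) ex_x0; lra.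
Qed.

(** Equality forces v_j >= Delta v_0 - 1 = Delta - 2, which is also the upper bound. *)
Lemma ex_objective_unique (v : 'cV[R]_N.+2) : polyhedron ex_A ex_b R v ->
  v ord0 0 = ex_x ord0 0 -> v = ex_x.
Proof.
move=> /ex_polyhedronP vP v0; apply/colP => i; case: (unliftP ord0 i) => [j|] -> //.
by have := vP j; rewrite v0 ex_x0 ex_xj; lra.
Qed.

Lemma ex_x_feasible : polyhedron ex_A ex_b R ex_x.
Proof. by apply/ex_polyhedronP => j; rewrite ex_x0 ex_xj; have := D3; lra. Qed.

Lemma ex_lp_optimal_vertex : lp_optimal_vertex ex_A ex_b (delta_mx ord0 0) ex_x.
Proof.
split; last first.
  move=> v /ex_objective_le; rewrite map_delta_mx /= !delta_mxTE //.
exists (delta_mx ord0 0), (ex_x ord0 0); split.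
  by move=> v /ex_objective_le; rewrite delta_mxTE.
apply/seteqP; split=> v /=; first by move->; split; [exact: ex_x_feasible|rewrite delta_mxTE].
by rewrite delta_mxTE => -[]; apply: ex_objective_unique.
Qed.

(** The integer Delta z_0 lies between 0 and Delta - 1, so z_0 = 0; then both z_j and -z_j are
    nonnegative. *)
Lemma ex_ip_feasible (z : 'cV[int]_N.+2) : ip_feasible ex_A ex_b z -> z = 0.
Proof.
move/(ip_feasible_polyhedron R)/ex_polyhedronP => zP.
have z0 : z ord0 0 = 0.
  have := zP ord0; rewrite !mxE -[Delta%:R]/(Delta%:Z%:~R) -intrM -intrB.
  rewrite -[2]/(2%:~R) -[1]/(1%:~R) -intrB !ler_int ler0z ler0z; nia.
apply/colP => i; rewrite [RHS]mxE; case: (unliftP ord0 i) => [j|] -> //.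
have := zP j; rewrite !mxE z0 mulr0 => zj; apply/eqP; rewrite -(intr_eq0 R); apply/eqP; lra.
Qed.

(** Coordinate 0 contributes less than 1, which is at most Delta - 2 because [Delta] is at least
    3. *)
Lemma ex_dist : dist_infty ex_x 0 = Delta%:R - 2.
Proof.
rewrite /dist_infty map_mx0 subr0; apply/eqP; rewrite eq_le; apply/andP; split.
  apply: mx_norm_le => [|i]; first by have := D3; lra.
  case: (unliftP ord0 i) => [j|] ->; first by rewrite ex_xj ger0_norm //; have := D3; lra.
  rewrite -(ler_pM2l D0) -{1}(gtr0_norm D0) -normrM ex_x0 ger0_norm; have := D3; nra.
apply: le_trans (mx_norm_ge _ (lift ord0 ord0)).
by rewrite ex_xj ler_norm.
Qed.

End TightExample.

Theorem theorem3 (R : realType) (Delta n : nat)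
    (hDelta : (1 <= Delta)%N) (hn : (2 <= n)%N) :
  (forall (m : nat) (A : 'M[int]_(m, n)) (b : 'cV[int]_m) (c : 'cV[rat]_n),
      full_column_rank A -> strictly_modular Delta A ->
      (exists z : 'cV[int]_n, ip_feasible A b z) ->
      forall x : 'cV[R]_n, lp_optimal_vertex A b c x ->
      exists z : 'cV[int]_n, ip_optimal A b c z /\
        dist_infty x z
          <= (maxn (max_subdet n.-1 A) (max_subdet n A))%:R - 1)
  /\
  ((3 <= Delta)%N ->
    exists (m : nat) (A : 'M[int]_(m, n)) (b : 'cV[int]_m) (c : 'cV[rat]_n),
      [/\ full_column_rank A, strictly_modular Delta A,
          exists z : 'cV[int]_n, ip_feasible A b z,
          full_dim (polyhedron A b R) &
          exists x : 'cV[R]_n, lp_optimal_vertex A b c x /\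
            forall z : 'cV[int]_n, ip_feasible A b z ->
              dist_infty x z
                = (maxn (max_subdet n.-1 A) (max_subdet n A))%:R - 2 /\
              ~ (exists F : set 'cV[R]_n,
                   [/\ facet (polyhedron A b R) F, F x
                     & F (map_mx intr z)])]).
Proof.
(* Writing the dimension as [n.+2] makes its predecessor compute and leaves at least one coordinate
   besides the first for the example. *)
case: n hn => [|[|n]] // _; split=> [m A b c rA sA feas x xv|D3].
  exact: (proximity hDelta rA sA feas xv).
exists _, (ex_A Delta n), (ex_b Delta n), (delta_mx ord0 0); split.
- exact: ex_full_column_rank.
- exact: ex_strictly_modular.
- exists 0; apply/(ip_feasible_polyhedron R)/ex_polyhedronP => j.
  have : 3 <= Delta%:R :> R by rewrite ler_nat.
  by rewrite map_mx0 !mxE; lra.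
- exact: strictly_feasible_full_dim (ex_strictly_feasible D3 R).
exists (ex_x Delta n R); split; first exact: ex_lp_optimal_vertex.
move=> z /(ex_ip_feasible D3 R) ->; rewrite ex_max_subdet //; split; first exact: ex_dist.
move=> [F [facetF Fx]]; rewrite map_mx0.
exact: (strictly_feasible_facet (ex_strictly_feasible D3 R) erefl facetF Fx).
Qed.
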